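(* Let $\mathcal{G}$ be a generalised quadrangle of order $(s,s^2)$, let $P$ be a point of $\mathcal{G}$ and let $\infty=P^\perp$. Let $\mathcal{I}$ be a positive intriguing set of $\mathcal{G}$ such that $\mathcal{I}\setminus\infty$ is a nonempty proper subset of the point set of $\mathcal{G}\setminus\infty$. Then $\mathcal{I}\setminus\infty$ is an intriguing set of the partial quadrangle $\mathcal{G}\setminus\infty$ if and only if $\mathcal{I}\cap\infty$ consists, apart possibly from the point $P$, of $y$ lines through $P$ for some $y$; that is, $(\mathcal{I}\cap\infty)\setminus\{P\}=(\ell_1\cup\dots\cup\ell_y)\setminus\{P\}$ for some $y$ lines $\ell_1,\dots,\ell_y$ through $P$.
   Context: A generalised quadrangle of order $(s,t)$ is a point-line incidence structure in which two distinct points are on at most one line, every line has $s+1$ points, every point is on $t+1$ lines, and for every point $X$ not on a line $\ell$ there is exactly one point of $\ell$ collinear with $X$; here $s\ge2$. $P^\perp$ is the set of all points collinear with $P$, including $P$; lines are identified with their point sets. $\mathcal{G}\setminus P^\perp$ denotes the geometry whose points are the points of $\mathcal{G}$ not collinear with $P$ and whose lines are the lines of $\mathcal{G}$ not through $P$. For $\mathcal{G}$ of order $(s,s^2)$ it is a partial quadrangle $\mathsf{PQ}(s-1,s^2,s(s-1))$: lines have $s$ points, points are on $s^2+1$ lines, for each non-incident point-line pair at most one point of the line is collinear with the point, and two non-collinear points have exactly $s(s-1)$ points collinear with both. A nonempty proper subset $\mathcal{I}$ of the points of a generalised or partial quadrangle is an intriguing set with parameters $(h_1,h_2)$ if the number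 of points of $\mathcal{I}$ collinear with and distinct from a point $X$ is $h_1$ if $X\in\mathcal{I}$ and $h_2$ if $X\notin\mathcal{I}$. An intriguing set of $\mathcal{G}$ is positive if $h_1-h_2=s-1$ (the positive eigenvalue, other than the valency, of its point graph). *)

(* Defs.v *)
From mathcomp Require Import all_boot.

Set Implicit Arguments.
Unset Strict Implicit.
Unset Printing Implicit Defensive.

Record geometry := Geometry {
  point : finType;
  line : finType;
  incident : point -> line -> bool
}.

Section Geometry.
Variable G : geometry.
Implicit Types (x y : point G) (l m : line G) (I : {set point G}).

Definition line_points l : {set point G} := [set x | incident x l].

Definition lines_through x : {set line G} := [set l | incident x l].

Definition collinear x y : bool := [exists l, incident x l && incident y l].

Definition perp x : {set point G} := [set y | (y == x) || collinear x y].

Definition generalised_quadrangle (s t : nat) : Prop :=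
  [/\ forall x y l m, x != y -> incident x l -> incident y l ->
        incident x m -> incident y m -> l = m,
      forall l, #|line_points l| = s.+1,
      forall x, #|lines_through x| = t.+1
    & forall x l, ~~ incident x l ->
        exists! y, incident y l /\ collinear x y].

Definition intriguing_with (h1 h2 : nat) I : Prop :=
  [/\ I != set0, I \proper [set: point G]
    & forall x, #|[set y in I | (y != x) && collinear x y]|
                = if x \in I then h1 else h2].

Definition intriguing I : Prop := exists h1 h2, intriguing_with h1 h2 I.

(* h1 - h2 = s - 1, written without a truncated difference of h1 and h2. *)
Definition positive_intriguing (s : nat) I : Prop :=
  exists h1 h2, intriguing_with h1 h2 I /\ h1 = h2 + (s - 1).

(* The geometry on the points not collinear with P, whose lines are the lines
   not through P; incidence is inherited. *)
Definition affine_part (P : point G) : geometry :=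
  @Geometry {x : point G | x \notin perp P} {l : line G | ~~ incident P l}
    (fun u k => incident (val u) (val k)).

Definition affine_trace (P : point G) I : {set point (affine_part P)} :=
  [set u : {x : point G | x \notin perp P} | val u \in I].

End Geometry.

(* Main.v *)
Require Import Defs.
From mathcomp Require Import all_boot.
From mathcomp Require Import zify.

Set Implicit Arguments.
Unset Strict Implicit.
Unset Printing Implicit Defensive.

(** Call a point affine when it is not in [perp P], and for such a point [x] let
    [A x] be the number of common neighbours of [x] and [P] that lie in [I].
    An affine point loses exactly [A x] of its neighbours in [I] when [perp P]
    is removed ([card_affine_trace]), so the trace of [I] is intriguing exactly
    when [A] takes one value [a] on the affine points of [I] and one value [b]
    on the other affine points.

    If [I] meets [perp P] in [y] lines through [P], up to [P], then [A x = y]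
    everywhere, because [x] is collinear with exactly one point of each line
    through [P] and that point is not [P].

    Conversely, let [Q] and [Q'] be points other than [P] on a line [l] through
    [P], with [Q] in [I] and [Q'] not in [I].  Counting pairs of collinear
    points gives the sum of [A] over the affine neighbours of [Q]
    ([sum_trace_counts]): each point of [I] on another line through [P] is
    counted [t] times, and [Q] itself [s * t] times.  Compare with the same sum
    for [Q'].  The points of the other lines contribute equally, while positivity
    of [I] makes [Q] have exactly [s] more affine neighbours in [I] than [Q'].
    This forces [a = b + t] ([trace_counts_difference]).

    Since [A x <= t + 1], either [(a, b) = (t + 1, 1)] or [(a, b) = (t, 0)], and
    replacing [I] by its complement exchanges the two cases.  In the first one,
    all neighbours in [I] of an affine point [X] outside [I] lie on one line, so
    there are at most [s] of them, while an affine point of [I] has at least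
    [t + 1] neighbours in [I].  The difference of these numbers is [s - 1], which
    is impossible when [2 * s <= t + 1] ([saturated_set_absurd]); [t = s ^ 2]
    satisfies this.  So each line through [P] has all or none of its points
    other than [P] in [I]. *)

(** * Collinearity *)

Definition neighbours (G : geometry) (x : point G) : {set point G} :=
  [set y | (y != x) && collinear x y].

Section Collinearity.
Variable G : geometry.
Implicit Types (x y z P : point G) (l m : line G) (A : {set point G}).

Lemma collinearP x y :
  reflect (exists2 l, incident x l & incident y l) (collinear x y).
Proof.
by apply: (iffP existsP) => [[l /andP[xl yl]]|[l xl yl]]; exists l => //; apply/andP.
Qed.

Lemma collinear_sym x y : collinear x y = collinear y x.
Proof. by apply/collinearP/collinearP => -[l ? ?]; exists l. Qed.

Lemma neighbours_sym x y : (y \in neighbours x) = (x \in neighbours y).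
Proof. by rewrite !inE eq_sym collinear_sym. Qed.

Lemma perpE x : perp x = x |: neighbours x.
Proof. by apply/setP => y; rewrite !inE; case: eqP. Qed.

Lemma neighbours_incident x y l :
  y != x -> incident x l -> incident y l -> y \in neighbours x.
Proof. by move=> yx xl yl; rewrite inE yx; apply/collinearP; exists l. Qed.

Lemma notin_perp_incident x y l :
  y \notin perp x -> incident y l -> ~~ incident x l.
Proof.
rewrite inE negb_or => /andP[_ nxy] yl; apply: contra nxy => xl.
by apply/collinearP; exists l.
Qed.

Lemma notin_perp_sym x y : (y \notin perp x) = (x \notin perp y).
Proof. by rewrite !inE eq_sym collinear_sym. Qed.

(** This is what ties the points lost by a neighbourhood when [perp P] is
    removed to common neighbours with [P]: [P] itself is not lost, as it is no
    neighbour of an affine point. *)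
Lemma common_neighbours_perp P x : x \notin perp P ->
  neighbours x :&: perp P = neighbours P :&: neighbours x.
Proof.
move=> xP; apply/setP => y; rewrite perpE !in_setI in_setU1 andbC.
case: eqVneq => //= ->; rewrite neighbours_sym.
by move: xP; rewrite perpE in_setU1 negb_or => /andP[_ /negPf->]; rewrite andbF.
Qed.

End Collinearity.

(** * Counting in a generalised quadrangle *)

Section GeneralisedQuadrangle.
Variables (s t : nat) (G : geometry).
Hypothesis GQ : generalised_quadrangle G s t.
Implicit Types (x y z P Q R : point G) (l m : line G) (A I J : {set point G}).

Lemma line_unique x y l m : x != y -> incident x l -> incident y l ->
  incident x m -> incident y m -> l = m.
Proof. by case: GQ => H _ _ _; apply: H. Qed.

(** If [z] were off [l], both [x] and [y] would be its unique projection on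
    [l]. *)
Lemma triangle_free x y z l : x != y -> incident x l -> incident y l ->
  collinear z x -> collinear z y -> incident z l.
Proof.
case: GQ => _ _ _ H xy xl yl zx zy; apply: contraT => /H[w [_ wU]].
by case/eqP: xy; rewrite -(wU x) // (wU y).
Qed.

Lemma neighbours_triangle x y z l : y \in neighbours x ->
  incident x l -> incident y l ->
  z \in neighbours x -> z \in neighbours y -> incident z l.
Proof.
rewrite !inE => /andP[yx _] xl yl /andP[_ xz] /andP[_ yz].
by apply: (triangle_free yx) => //; rewrite collinear_sym.
Qed.

(** The lines through [x], with [x] removed, partition the neighbours of [x].
    Every count around a point below goes through this identity. *)
Lemma card_neighboursI x A : #|A :&: neighbours x| =
  \sum_(l in lines_through x) #|A :&: (line_points l :\ x)|.
Proof.
transitivity (\sum_(l in lines_through x)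
    \sum_(y in A | y \in line_points l :\ x) 1); last first.
  by apply: eq_bigr => l _; rewrite -sum1_card; apply: eq_bigl => y; rewrite !inE.
rewrite (exchange_big_dep (mem A)) /=; last by move=> l y _ /andP[].
rewrite -sum1_card.
rewrite (eq_bigl (fun y => (y \in A) && (y \in neighbours x))); last first.
  by move=> y; rewrite in_setI.
rewrite big_mkcondr /=; apply: eq_bigr => y yA; rewrite inE.
under [RHS]eq_bigl => l do rewrite yA /= !inE.
case: ifP => [/andP[yx /collinearP[l xl yl]]|/negP yn].
  rewrite (big_pred1 l) // => m; rewrite yx /=.
  apply/andP/eqP => [[xm ym]|-> //]; exact: (line_unique yx ym xm yl xl).
rewrite big_pred0 // => m; apply/negP => /and3P[xm yx ym].
by apply: yn; rewrite yx; apply/collinearP; exists m.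
Qed.

Lemma card_line_punctured x l : incident x l -> #|line_points l :\ x| = s.
Proof.
case: GQ => _ /(_ l) sl _ _ xl.
by move: sl; rewrite (cardsD1 x) inE xl add1n => -[].
Qed.

Lemma card_neighbours x : #|neighbours x| = s * t.+1.
Proof.
case: GQ => _ _ /(_ x) <- _.
rewrite -[neighbours x]setTI card_neighboursI mulnC -sum_nat_const.
by apply: eq_bigr => l; rewrite inE setTI => /card_line_punctured.
Qed.

Lemma projection x l : ~~ incident x l ->
  exists2 y, y \in neighbours x & neighbours x :&: line_points l = [set y].
Proof.
case: GQ => _ _ _ H xl; have [y [[yl xy] yU]] := H x l xl.
have neq z : incident z l -> z != x by apply: contraTneq => ->.
exists y; first by rewrite inE xy neq.
apply/setP => z; rewrite !inE; apply/idP/eqP => [/andP[/andP[_ xz] zl]|->].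
  by rewrite (yU z).
by rewrite neq // xy.
Qed.

Lemma projection_neighbour x P l : x \notin perp P -> incident P l ->
  exists2 y, y \in neighbours x & neighbours x :&: (line_points l :\ P) = [set y].
Proof.
move=> xP Pl; have xl : ~~ incident x l.
  by apply: (notin_perp_incident _ Pl); rewrite notin_perp_sym.
have [y xy yE] := projection xl; exists y => //.
rewrite setDE setIA yE; apply/setIidPl; rewrite sub1set !inE.
by apply: contraNneq xP => <-; rewrite perpE inE -neighbours_sym xy orbT.
Qed.

Lemma card_common_neighbours x y : x \notin perp y ->
  #|neighbours x :&: neighbours y| = t.+1.
Proof.
move=> xy; case: GQ => _ _ /(_ y) <- _.
rewrite card_neighboursI -[RHS]sum1_card.
apply: eq_bigr => l; rewrite inE => yl.
by have [z _ ->] := projection_neighbour xy yl; rewrite cards1.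
Qed.

Lemma neighboursI_perp Q P l : Q \in neighbours P -> incident P l ->
  incident Q l -> neighbours Q :&: perp P = line_points l :\ Q.
Proof.
move=> QP Pl Ql; apply/setP => x; rewrite perpE 2!inE in_setU1 in_setD1 [in RHS]inE.
apply/andP/andP => -[].
  move=> xQ xP; move: (xQ) => /andP[-> _]; split=> //.
  case/orP: xP => [/eqP->//|xP].
  by apply: (neighbours_triangle QP Pl Ql xP); rewrite inE.
move=> xQ xl; rewrite xQ; split; first by apply/collinearP; exists l.
by case: eqVneq => //= xP; apply: neighbours_incident xP Pl xl.
Qed.

Lemma card_neighboursD_perp Q P : Q \in neighbours P ->
  #|neighbours Q :\: perp P| = s * t.
Proof.
move=> QP; move: (QP); rewrite inE => /andP[_ /collinearP[l Pl Ql]].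
have := cardsID (perp P) (neighbours Q).
rewrite (neighboursI_perp QP Pl Ql) card_line_punctured // card_neighbours.
lia.
Qed.

(** When [R] is not on [l], the points [Q] and [R] are not collinear and have
    [t + 1] common neighbours.  Only [P] among them is in [perp P]: another one
    would form triangles with [P, Q] and with [P, R], hence be on both lines.
    When [R] is on [l], a common neighbour is on [l] too, hence in [perp P]. *)
Lemma card_common_neighboursD_perp P Q R l : Q \in neighbours P ->
    incident P l -> incident Q l -> R \in neighbours P ->
  #|(neighbours Q :\: perp P) :&: neighbours R| =
  if R == Q then s * t else if incident R l then 0 else t.
Proof.
move=> QP Pl Ql RP; case: eqVneq => [->|RQ].
  by rewrite setIC setIDA setIid card_neighboursD_perp.
case: ifPn => Rl.
  apply/eqP; rewrite cards_eq0 -subset0; apply/subsetP => x.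
  rewrite !in_setI in_setD => /andP[/andP[xP xQ] xR].
  have RQn := neighbours_incident RQ Ql Rl.
  have xl := neighbours_triangle RQn Ql Rl xQ xR.
  by have := notin_perp_incident xP xl; rewrite Pl.
have RnQ : Q \notin perp R.
  rewrite notin_perp_sym perpE in_setU1 (negPf RQ) /=.
  by apply: contra Rl => RnQ; apply: (neighbours_triangle QP).
have := cardsD1 P (neighbours Q :&: neighbours R).
rewrite card_common_neighbours // in_setI !(neighbours_sym _ P) QP RP add1n.
case=> ->; apply: eq_card => x; rewrite perpE !in_setI in_setD in_setD1 in_setU1 in_setI.
case: (boolP (x \in neighbours Q)) => xQ; rewrite ?andbF //=.
case: (boolP (x \in neighbours R)) => xR; rewrite ?andbF //= !andbT negb_or.
case: eqVneq => //= xP; apply: contraT; rewrite negbK => xnP.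
have xl : incident x l := neighbours_triangle QP Pl Ql xnP xQ.
have /collinearP[m Pm Rm] : collinear P R by move: RP; rewrite inE => /andP[].
have xm : incident x m := neighbours_triangle RP Pm Rm xnP xR.
by case/negP: Rl; rewrite (line_unique xP xl Pl xm Pm).
Qed.

(** Both sides count the pairs [(x, R)] of collinear points with [x] an affine
    neighbour of [Q] and [R] a neighbour of [P] in [I]; the points [R] on [l]
    other than [Q] have no such [x]. *)
Lemma sum_trace_counts I P Q l : Q \in neighbours P ->
    incident P l -> incident Q l ->
  \sum_(x in neighbours Q :\: perp P) #|I :&: neighbours P :&: neighbours x| =
  t * (s * (Q \in I) + #|(I :&: neighbours P) :\: line_points l|).
Proof.
move=> QP Pl Ql.
rewrite (eq_bigr (fun x => \sum_(R in I :&: neighbours P | R \in neighbours x) 1));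
  last by move=> x _; rewrite -sum1_card; apply: eq_bigl => y; rewrite !inE.
rewrite (exchange_big_dep (mem (I :&: neighbours P))) /=; last by move=> x R _ /andP[].
rewrite (eq_bigr (fun R => (R == Q) * (s * t) + (R \notin line_points l) * t)); last first.
  move=> R RIP; have /setIP[_ RP] := RIP.
  rewrite [R \in line_points l]inE.
  transitivity (#|(neighbours Q :\: perp P) :&: neighbours R|).
    rewrite -sum1_card; apply: eq_bigl => y.
    by rewrite [RHS]in_setI [y \in neighbours R]neighbours_sym RIP.
  rewrite (card_common_neighboursD_perp QP Pl Ql RP).
  by case: eqVneq => [->|_]; rewrite ?Ql /=; [lia | case: incident; lia].
rewrite big_split /= -!big_distrl /=.
have -> : \sum_(R in I :&: neighbours P) (R \notin line_points l) =
          #|(I :&: neighbours P) :\: line_points l|.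
  transitivity (\sum_(R in I :&: neighbours P | R \notin line_points l) 1).
    by rewrite big_mkcondr /=; apply: eq_bigr => R _; case: (R \notin _).
  by rewrite -sum1_card; apply: eq_bigl => R; rewrite in_setD andbC.
have -> : \sum_(R in I :&: neighbours P) (R == Q) = (Q \in I).
  rewrite (eq_bigr (fun R => if R == Q then 1 else 0)); last by move=> R _; case: eqP.
  rewrite -big_mkcondr /=; case: (boolP (Q \in I)) => QI.
    rewrite (big_pred1 Q) // => R /=; rewrite in_setI.
    by case: eqVneq => [->|]; rewrite ?andbF // QI QP.
  rewrite big_pred0 // => R; apply/negP => /andP[/setIP[RI _] /eqP RQ].
  by rewrite RQ (negPf QI) in RI.
by lia.
Qed.

(** The neighbours of [Q] in [perp P] are the other points of [l]; counting all
    of [l] on the left is balanced by the summand for [Q] on the right. *)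
Lemma card_neighboursI_off_perp I P Q l : Q \in neighbours P ->
    incident P l -> incident Q l ->
  #|I :&: (neighbours Q :\: perp P)| + #|I :&: line_points l| =
  #|I :&: neighbours Q| + (Q \in I).
Proof.
move=> QP Pl Ql; rewrite -(cardsID (perp P) (I :&: neighbours Q)).
rewrite -setIA (neighboursI_perp QP Pl Ql) (cardsD1 Q (I :&: line_points l)).
by rewrite !inE Ql andbT !setIDA; lia.
Qed.

(** Write the identity [sum_trace_counts] for [Q] and for [Q'].  The term for
    the points off [l] is the same.  Positivity of [I] gives [Q] exactly [s - 1]
    more neighbours in [I] than [Q'], and on [l] it has one fewer, as only [Q']
    has [Q] as a neighbour; so it has [s] more affine ones, and subtraction gives
    [s * (a - b) = s * t]. *)
Lemma trace_counts_difference I P Q Q' l a b h1 h2 :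
    0 < s -> h1 + 1 = h2 + s ->
    (forall x, #|I :&: neighbours x| = if x \in I then h1 else h2) ->
    (forall x, x \notin perp P ->
      #|I :&: neighbours P :&: neighbours x| = if x \in I then a else b) ->
    Q \in neighbours P -> Q' \in neighbours P -> incident P l ->
    incident Q l -> incident Q' l -> Q \in I -> Q' \notin I ->
  a = b + t.
Proof.
move=> s0 h12 hI ab QP Q'P Pl Ql Q'l QI Q'I.
have total R : R \in neighbours P -> incident R l ->
    a * #|I :&: (neighbours R :\: perp P)| +
    b * (s * t - #|I :&: (neighbours R :\: perp P)|) =
    t * (s * (R \in I) + #|(I :&: neighbours P) :\: line_points l|).
  move=> RP Rl; rewrite -(sum_trace_counts I RP Pl Rl).
  set D := neighbours R :\: perp P.
  rewrite (eq_bigr (fun x => if x \in I then a else b)); last first.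
    by move=> x; rewrite in_setD => /andP[xP _]; rewrite ab.
  rewrite (bigID (mem I)) /= -(card_neighboursD_perp RP) -/D.
  rewrite -[#|D|](cardsID I) [D :&: I]setIC addKn.
  rewrite mulnC [b * _]mulnC -!sum_nat_const; congr (_ + _).
    apply: eq_big => x; first by rewrite in_setI andbC.
    by case/setIP=> ->.
  apply: eq_big => x; first by rewrite in_setD andbC.
  by case/setDP=> _ /negPf->.
have bound R : R \in neighbours P ->
    #|I :&: (neighbours R :\: perp P)| <= s * t.
  by move=> RP; rewrite -(card_neighboursD_perp RP) subset_leq_card ?subsetIr.
have := total Q QP Ql; have := total Q' Q'P Q'l.
have := bound Q QP; have := bound Q' Q'P.
have := card_neighboursI_off_perp I QP Pl Ql; have := card_neighboursI_off_perp I Q'P Pl Q'l.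
rewrite !hI QI (negPf Q'I).
set d := #|I :&: (neighbours Q :\: _)|; set d' := #|I :&: (neighbours Q' :\: _)|.
move: (s * t) => st.
set n := #|I :&: line_points l|; set r := #|_ :\: line_points l|.
move=> e1 e2 le1 le2 e3 e4.
have dd : d = d' + s by lia.
apply/eqP; rewrite -(eqn_pmul2r s0); apply/eqP.
have uu : st - d' = st - d + s by lia.
move: e3 e4; rewrite uu dd; nia.
Qed.

(** * Excluding a line that lies only partly in the set *)

(** Let [Z] be the neighbour of [X] in [J] and [perp P].  A line through [X]
    containing a point [W] of [J] meets [perp P] in a point that is [W] or a
    common neighbour of [W] and [P], hence is in [J], hence is [Z].  So all
    neighbours of [X] in [J] lie on the line [XZ], and there are at most [s] of
    them.  But the [t + 1] common neighbours of [Y] and [P] are all in [J], so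
    [Y] would have at least [s] more neighbours in [J] than [X]. *)
Lemma saturated_set_absurd J P X Y : 2 * s <= t.+1 ->
    X \notin perp P -> X \notin J -> Y \notin perp P -> Y \in J ->
    #|J :&: neighbours Y| + 1 = #|J :&: neighbours X| + s ->
    #|J :&: neighbours P :&: neighbours X| = 1 ->
    (forall W, W \notin perp P -> W \in J ->
      neighbours P :&: neighbours W \subset J) ->
  False.
Proof.
move=> st XP XJ YP YJ hJ /eqP/cards1P[Z ZE] full.
have [ZJ ZP ZX] : [/\ Z \in J, Z \in neighbours P & Z \in neighbours X].
  have : Z \in [set Z] by rewrite inE.
  by rewrite -ZE => /setIP[/setIP[-> ->] ->].
have /collinearP[l Xl Zl] : collinear X Z by move: ZX; rewrite inE => /andP[].
have hX : #|J :&: neighbours X| <= s.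
  rewrite -(card_line_punctured Xl); apply: subset_leq_card.
  apply/subsetP => W /setIP[WJ WX].
  move: (WX); rewrite inE => /andP[WneX /collinearP[m Xm Wm]].
  rewrite in_setD1 WneX /= inE.
  (* V is the point where the line m through X and W meets perp P. *)
  have [V VP VE] := projection (notin_perp_incident XP Xm).
  have Vm : incident V m.
    have : V \in [set V] by rewrite inE.
    by rewrite -VE !inE => /andP[].
  have VX : V \in neighbours X.
    apply: neighbours_incident Xm Vm; apply: contraNneq XP => <-.
    by rewrite perpE inE VP orbT.
  have VJ : V \in J.
    case: (eqVneq V W) => [->//|VW].
    have WP : W \notin perp P.
      rewrite perpE in_setU1 negb_or; apply/andP; split.
        by apply: contraNneq (notin_perp_incident XP Xm) => <-.
      apply/negP => WP; have : W \in neighbours P :&: line_points m by rewrite in_setI WP inE.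
      by rewrite VE inE eq_sym (negPf VW).
    apply: (subsetP (full W WP WJ)); rewrite in_setI VP /=.
    exact: neighbours_incident VW Wm Vm.
  have /eqP VZ : V == Z by rewrite -in_set1 -ZE !in_setI VJ VP VX.
  have XV : X != V by rewrite eq_sym; move: VX; rewrite inE => /andP[].
  by rewrite (line_unique XV Xl _ Xm Vm) // VZ.
have hY : t.+1 <= #|J :&: neighbours Y|.
  rewrite -(card_common_neighbours YP) setIC; apply: subset_leq_card.
  by rewrite subsetI (full Y) // subsetIr.
lia.
Qed.

(** As [a <= t + 1], only [b = 1] and [b = 0] are possible.  If [b = 1] then
    [a = t + 1] and [I] satisfies [saturated_set_absurd]; if [b = 0] then
    [a = t] and the complement of [I] does, with [X] and [Y] exchanged. *)
Lemma trace_counts_difference_neq I P X Y a b h1 h2 :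
    2 * s <= t.+1 -> h1 + 1 = h2 + s ->
    (forall x, #|I :&: neighbours x| = if x \in I then h1 else h2) ->
    (forall x, x \notin perp P ->
      #|I :&: neighbours P :&: neighbours x| = if x \in I then a else b) ->
    X \notin perp P -> X \notin I -> Y \notin perp P -> Y \in I ->
  a <> b + t.
Proof.
move=> st h12 hI ab XP XI YP YI abt.
have compl x : #|~: I :&: neighbours x| + #|I :&: neighbours x| = s * t.+1.
  by rewrite addnC ![_ :&: neighbours x]setIC -setDE cardsID card_neighbours.
have split x : x \notin perp P ->
    #|~: I :&: neighbours P :&: neighbours x| +
    #|I :&: neighbours P :&: neighbours x| = t.+1.
  move=> xP; rewrite -!setIA addnC ![_ :&: (neighbours P :&: _)]setIC -setDE cardsID.
  by rewrite setIC card_common_neighbours.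
have full x J : #|~: J :&: neighbours P :&: neighbours x| = 0 ->
    neighbours P :&: neighbours x \subset J.
  by move/eqP; rewrite cards_eq0 -setIA setIC -setDE setD_eq0.
have aY := split Y YP; rewrite ab // YI in aY.
have aX := split X XP; rewrite ab // (negPf XI) in aX.
have [b1|b0] : b = 1 \/ b = 0 by lia.
  apply: (@saturated_set_absurd I P X Y) => //.
  - by rewrite !hI YI (negPf XI).
  - by rewrite ab // (negPf XI).
  - move=> W WP WI; apply: full.
    by have := split W WP; rewrite ab // WI; lia.
apply: (@saturated_set_absurd (~: I) P Y X) => //; rewrite ?in_setC ?YI ?XI //.
- by have := compl X; have := compl Y; rewrite !hI YI (negPf XI); lia.
- by lia.
- move=> W WP; rewrite in_setC => /negPf WI; apply: full.
  by rewrite setCK ab // WI.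
Qed.

End GeneralisedQuadrangle.

(** * The trace on the affine part *)

Section Trace.
Variables (G : geometry) (P : point G) (I : {set point G}).

(** No line is lost between two affine points: a line through an affine point
    does not contain [P]. *)
Lemma collinear_affine (u v : point (affine_part P)) :
  collinear u v = collinear (val u) (val v).
Proof.
apply/collinearP/collinearP => -[l ul vl]; first by exists (val l).
by exists (Sub l (notin_perp_incident (valP u) ul)).
Qed.

Lemma card_affine_trace (u : point (affine_part P)) :
  #|[set v in affine_trace P I | (v != u) && collinear u v]| +
  #|I :&: neighbours P :&: neighbours (val u)| = #|I :&: neighbours (val u)|.
Proof.
rewrite -(cardsID (perp P) (I :&: neighbours (val u))) addnC; congr (_ + _).
  by rewrite -!setIA (common_neighbours_perp (valP u)).
rewrite -(card_imset _ val_inj); apply: eq_card => x.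
apply/imsetP/idP => [[v vE ->]|].
  move: vE; rewrite !inE collinear_affine => /andP[vI /andP[vu uv]].
  by have := valP v; rewrite !inE vI uv => ->; rewrite andbT.
rewrite in_setD => /andP[xP /setIP[xI]]; rewrite inE => /andP[xu ux].
by exists (Sub x xP); rewrite ?SubK // !inE collinear_affine SubK xI ux andbT.
Qed.

End Trace.

Theorem theorem5p2 (s : nat) (G : geometry) (P : point G)
    (I : {set point G}) :
  2 <= s ->
  generalised_quadrangle G s (s ^ 2) ->
  positive_intriguing s I ->
  affine_trace P I != set0 ->
  affine_trace P I \proper [set: point (affine_part P)] ->
  intriguing (affine_trace P I) <->
  exists (y : nat) (L : {set line G}),
    [/\ #|L| = y,
        L \subset lines_through P
      & (I :&: perp P) :\ P = (\bigcup_(l in L) line_points l) :\ P].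
Proof.
move=> s2 GQ [h1 [h2 [[I0 IT hI] h12]]] tr0 trT.
have {}h12 : h1 + 1 = h2 + s by lia.
have {}hI x : #|I :&: neighbours x| = if x \in I then h1 else h2.
  by rewrite -hI; apply: eq_card => y; rewrite !inE.
have perpI : (I :&: perp P) :\ P = I :&: neighbours P.
  by apply/setP => x; rewrite perpE !inE; case: eqVneq; rewrite /= ?andbF.
rewrite perpI; split.
  move=> [k1 [k2 [_ _ hk]]].
  have ab x : x \notin perp P -> #|I :&: neighbours P :&: neighbours x| =
      if x \in I then h1 - k1 else h2 - k2.
    move=> xP; have := card_affine_trace I (Sub x xP).
    by rewrite hk SubK hI inE SubK; case: (x \in I); lia.
  have [Y YI] := set0Pn _ tr0; rewrite inE in YI.
  have [_ [X _ XI]] := properP trT; rewrite inE in XI.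
  (* Membership in I is constant on each line through P, outside P. *)
  have full l x y : incident P l -> x \in neighbours P -> incident x l ->
      y \in neighbours P -> incident y l -> x \in I -> y \in I.
    move=> Pl xP xl yP yl xI; apply: contraT => yI.
    have := @trace_counts_difference_neq _ _ _ GQ I P _ _ _ _ _ _ _ h12 hI ab
      (valP X) XI (valP Y) YI.
    case; first by nia.
    by apply: (trace_counts_difference GQ _ h12 hI ab xP yP Pl xl yl) => //; lia.
  pose L := [set l in lines_through P |
               [exists x in I :&: neighbours P, incident x l]].
  exists #|L|, L; split=> //; first by apply/subsetP => l; rewrite inE => /andP[].
  apply/setP => x; rewrite in_setD1; apply/idP/andP.
    move=> xIP; have /setIP[xI xP] := xIP.
    move: (xP); rewrite inE => /andP[xneP /collinearP[l Pl xl]]; split=> //.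
    apply/bigcupP; exists l; last by rewrite inE.
    by rewrite !inE Pl; apply/existsP; exists x; rewrite xIP xl.
  case=> xneP /bigcupP[l]; rewrite !inE => /andP[Pl /existsP[y]].
  case/andP=> /setIP[yI yP] yl xl.
  have xP := neighbours_incident xneP Pl xl.
  by move: (xP); rewrite inE (full l y x) // => ->.
move=> [y [L [Ly LP LE]]].
have ys x : x \notin perp P -> #|I :&: neighbours P :&: neighbours x| = y.
  move=> xP; rewrite -Ly -setIA [neighbours P :&: _]setIC setIA.
  (* Each line of L contributes the projection of x on it, and the other lines
     through P contribute nothing. *)
  rewrite (card_neighboursI GQ) (bigID (mem L)) /= addnC big1 ?add0n.
    rewrite -[RHS]sum1_card.
    apply: eq_big => l; first by rewrite andbC; case: (boolP (l \in L)) => // /(subsetP LP).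
    case/andP; rewrite inE => Pl lL; have [z _ zE] := projection_neighbour GQ xP Pl.
    rewrite -(cards1 z) -zE -setIA; congr #|pred_of_set _|.
    apply/setIidPr; apply/subsetP => w /setIP[_ wl].
    have : w \in I :&: neighbours P.
      rewrite LE; move: wl; rewrite !in_setD1 => /andP[-> wl].
      by apply/bigcupP; exists l.
    by case/setIP.
  move=> l /andP[]; rewrite inE => Pl lL; apply/eqP; rewrite cards_eq0 -subset0.
  apply/subsetP => w /setIP[/setIP[wI _]]; rewrite in_setD1 inE => /andP[wP wl].
  have : w \in I :&: neighbours P.
    by rewrite in_setI wI (neighbours_incident wP Pl wl).
  rewrite LE in_setD1 wP => /bigcupP[m mL]; rewrite inE => wm.
  have Pm : incident P m by have := subsetP LP m mL; rewrite inE.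
  by case/negP: lL; rewrite (line_unique GQ wP wl Pl wm Pm).
exists (h1 - y), (h2 - y); split=> // u.
have := card_affine_trace I u; rewrite ys ?(valP u) // hI inE.
by case: (_ \in I); lia.
Qed.
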